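(* Let $p$ be an odd prime and let $\mathbb{F}_p$ be the field with $p$ elements. For any element $s\in\mathbb{F}_p$ there exists a positive integer $m$ with the property that, for every natural number $n$, $S_n(s)=0$ in $\mathbb{F}_p$ if and only if $n$ is a multiple of $m$. Furthermore, $m$ divides either $p-1$ or $p+1$.
   Context: The spread polynomials $S_n(s)$, $n=0,1,2,\dots$, are defined recursively (over any field) by $S_0(s)=0$, $S_1(s)=s$, and $S_n(s)=2(1-2s)S_{n-1}(s)-S_{n-2}(s)+2s$ for $n\ge 2$. *)

(* Defs.v *)
From mathcomp Require Import all_boot all_algebra.

Set Implicit Arguments.
Unset Strict Implicit.
Unset Printing Implicit Defensive.

Import GRing.Theory.
Local Open Scope ring_scope.

(* The indeterminate 'X plays the role of s; evaluate with (spread_poly F n).[s]. *)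
Fixpoint spread_poly (F : fieldType) (n : nat) {struct n} : {poly F} :=
  match n with
  | 0 => 0
  | k.+1 =>
      match k with
      | 0 => 'X
      | j.+1 =>
          2%:R * (1 - 2%:R * 'X) * spread_poly F k - spread_poly F j + 2%:R * 'X
      end
  end.

(* Main.v *)
(** Over an algebraic closure of [F_p] write [1 - 2s = (u + u^-1)/2].  Then
    [4 S_n(s) = 2 - u^n - u^-n = - (u^n - 1)^2 / u^n], so [S_n(s) = 0] exactly
    when [u^n = 1], and [m] is the multiplicative order of [u].  The Frobenius
    map permutes the roots [u] and [u^-1] of [X^2 - (2 - 4s) X + 1], hence
    [u^p = u] or [u^p = u^-1]. *)
Require Import Defs.
From mathcomp Require Import all_boot all_algebra.
From mathcomp Require Import all_field.
From mathcomp Require Import ring.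

Set Implicit Arguments.
Unset Strict Implicit.
Unset Printing Implicit Defensive.

Import GRing.Theory.
Local Open Scope ring_scope.

Lemma spread_polySS (F : fieldType) (n : nat) :
  spread_poly F n.+2 =
  2%:R * (1 - 2%:R * 'X) * spread_poly F n.+1 - spread_poly F n + 2%:R * 'X.
Proof. by []. Qed.

Lemma horner_spread_polySS (F : fieldType) (s : F) (n : nat) :
  (spread_poly F n.+2).[s] =
  2%:R * (1 - 2%:R * s) * (spread_poly F n.+1).[s]
  - (spread_poly F n).[s] + 2%:R * s.
Proof. by rewrite spread_polySS -!polyC_natr !hornerE. Qed.

(** As [u] and [v] are the roots of [X^2 - (2 - 4s) X + 1], their powers satisfy
    [w_(n+2) = (2 - 4s) w_(n+1) - w_n], which is the homogeneous part of the spread recurrence. The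
    order is two, so the induction carries two consecutive indices. *)
Lemma spread_poly_powers (F : fieldType) (K : fieldType)
    (iota : {rmorphism F -> K}) (s : F) (u v : K) (n : nat) :
    u * v = 1 -> u + v = 2%:R - 4%:R * iota s ->
  4%:R * iota (spread_poly F n).[s] = 2%:R - u ^+ n - v ^+ n.
Proof.
move=> uv1 uvD.
suff: 4%:R * iota (spread_poly F n).[s] = 2%:R - u ^+ n - v ^+ n /\
      4%:R * iota (spread_poly F n.+1).[s] = 2%:R - u ^+ n.+1 - v ^+ n.+1.
  by case.
elim: n => [|n [IH0 IH1]].
  rewrite /= hornerC hornerX rmorph0; split; first by ring.
  by rewrite -addrA -opprD !expr1 uvD; ring.
split=> //.
rewrite horner_spread_polySS !(rmorphD, rmorphN, rmorphM, rmorphB, rmorph1, rmorph_nat).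
set a := iota (_ n.+1).[s] in IH1 *; set b := iota (_ n).[s] in IH0 *.
have -> : 4%:R * (2%:R * (1 - 2%:R * iota s) * a - b + 2%:R * iota s) =
    (2%:R - 4%:R * iota s) * (4%:R * a) - 4%:R * b + 8%:R * iota s by ring.
rewrite IH0 IH1 -uvD !exprS.
(* This eliminates [s], leaving a polynomial identity in [u], [v] and their [n]-th powers modulo
   [u * v = 1]. *)
have -> : 8%:R * iota s = 4%:R - 2%:R * (u + v) by rewrite uvD; ring.
ring: uv1.
Qed.

Lemma spread_poly_eq0 (F : fieldType) (K : fieldType)
    (iota : {rmorphism F -> K}) (s : F) (u v : K) (n : nat) :
    2%:R != 0 :> F -> u * v = 1 -> u + v = 2%:R - 4%:R * iota s ->
  ((spread_poly F n).[s] == 0) = (u ^+ n == 1).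
Proof.
move=> two_neq0 uv1 uvD.
have four_neq0 : 4%:R != 0 :> K.
  by rewrite -(rmorph_nat iota) fmorph_eq0 (natrM _ 2 2) mulf_neq0.
have unv1 : u ^+ n * v ^+ n = 1 by rewrite -exprMn uv1 expr1n.
have un_neq0 : u ^+ n != 0.
  by apply/eqP=> un0; move/eqP: unv1; rewrite un0 mul0r eq_sym oner_eq0.
(* The factor [u ^+ n] cancels [v ^+ n] and completes the square. *)
have sq : u ^+ n * (4%:R * iota (spread_poly F n).[s]) = - (u ^+ n - 1) ^+ 2.
  by rewrite (spread_poly_powers n uv1 uvD); ring: unv1.
rewrite -(fmorph_eq0 iota) -[RHS]subr_eq0 -[RHS](sqrf_eq0 (u ^+ n - 1)).
by rewrite -[RHS]oppr_eq0 -sq !mulf_eq0 (negPf un_neq0) (negPf four_neq0).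
Qed.

Lemma quadratic_roots_inverse (K : closedFieldType) (a : K) :
  exists u v : K, u * v = 1 /\ u + v = a.
Proof.
(* The coefficients [-1] and [a] encode the equation [u^2 = a u - 1]. *)
have [u def_u] := @solve_monicpoly K 2 (fun i => if i == 0 then -1 else a) isT.
have uP : u * (a - u) = 1.
  by rewrite mulrBr -expr2 def_u !big_ord_recl big_ord0 /=; ring.
by exists u, (a - u); split=> //; ring.
Qed.

Lemma frobenius_root_order (p : nat) (K : fieldType) (c u v : K) :
    p \in [pchar K] -> c ^+ p = c -> u * v = 1 -> u + v = c ->
  u ^+ p.-1 = 1 \/ u ^+ p.+1 = 1.
Proof.
move=> pcharK cp uv1 uvD.
have p_gt0 : (0 < p)%N by apply/prime_gt0/(pcharf_prime pcharK).
have u_neq0 : u != 0.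
  by apply/eqP=> u0; move/eqP: uv1; rewrite u0 mul0r eq_sym oner_eq0.
have upvp : u ^+ p * v ^+ p = 1 by rewrite -exprMn uv1 expr1n.
have upDvp : u ^+ p + v ^+ p = u + v.
  by rewrite uvD -cp -uvD -!(pFrobenius_autE pcharK) rmorphD.
(* The pairs [u, v] and [u ^+ p, v ^+ p] share sum and product, so [u ^+ p] is a root of
   [(X - u)(X - v)]. *)
have /eqP : (u ^+ p - u) * (u ^+ p - v) = 0.
  have -> : (u ^+ p - u) * (u ^+ p - v) = u ^+ p * (u ^+ p - (u + v)) + u * v.
    by ring.
  by rewrite -upDvp uv1 -upvp; ring.
rewrite mulf_eq0 !subr_eq0 => /orP[] /eqP up; [left | right].
  by apply: (mulfI u_neq0); rewrite -exprS prednK // up mulr1.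
by rewrite exprS up.
Qed.

Theorem theorem11 (p : nat) (p_prime : prime p) (p_odd : odd p) (s : 'F_p) :
  exists m : nat,
    [/\ (0 < m)%N,
        forall n : nat, (spread_poly 'F_p n).[s] = 0 <-> (m %| n)%N
      & (m %| p - 1)%N \/ (m %| p + 1)%N].
Proof.
(* Oddness of [p] enters here: it makes the factor 4 in [4 S_n(s)] invertible. *)
have two_neq0 : 2%:R != 0 :> 'F_p.
  rewrite -(dvdn_pcharf (pchar_Fp p_prime)) dvdn_prime2 //.
  by apply: contraTneq p_odd => ->.
have [K [iota _]] := countable_algebraic_closure 'F_p.
have [u [v [uv1 uvD]]] := quadratic_roots_inverse (iota (2%:R - 4%:R * s)).
have fermat (x : 'F_p) : x ^+ p = x by rewrite -{2}(expf_card x) card_Fp.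
have pcharK : p \in [pchar K] by rewrite (fmorph_pchar iota) pchar_Fp.
have [k k_gt0 [uk1 kP]] : exists2 k, (0 < k)%N &
    u ^+ k = 1 /\ (k = p - 1 \/ k = p + 1)%N.
  (* The trace [u + v] comes from the prime field, so Frobenius fixes it. *)
  have cp : iota (2%:R - 4%:R * s) ^+ p = iota (2%:R - 4%:R * s).
    by rewrite -rmorphXn fermat.
  have [u1|u1] := frobenius_root_order pcharK cp uv1 uvD.
    by exists (p - 1)%N; rewrite ?subn_gt0 ?prime_gt1 // subn1; split=> //; left.
  by exists (p + 1)%N; rewrite addn1 //; split=> //; right.
(* Here [m] is the exact order of [u], so it divides the exponent [k], which is [p - 1] or
   [p + 1]. *)
have [m prim_u m_dvd_k] := prim_order_exists k_gt0 uk1.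
exists m; split; first exact: prim_order_gt0 prim_u.
  move=> n; rewrite (prim_order_dvd prim_u).
  rewrite rmorphB rmorphM !rmorph_nat in uvD.
  by rewrite -(spread_poly_eq0 n two_neq0 uv1 uvD); split=> /eqP.
by case: kP => <-; [left | right].
Qed.
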